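(* Let $(X,\tau)$ be a locally compact Hausdorff space and set $(A,\rho,\mathbb{B})=(RC(X),\rho_X,CR(X))$. Let $\mathcal{K}_a(X)$ be the set of all normal contact relations $C$ on $A$ such that (RC1) $\rho\subseteq C$, and (RC2) for every $a\in A$ and every $b\in\mathbb{B}$, $aCb$ implies $a\rho b$, ordered by $C_1\preceq_c C_2$ iff $C_2\subseteq C_1$. Then there exists an isomorphism of posets $\mu_c:(\mathcal{K}(X),\le)\to(\mathcal{K}_a(X),\preceq_c)$.
   Context: For a topological space $X$, $RC(X)$ is the complete Boolean algebra of all regular closed subsets ($F=\mathrm{cl}(\mathrm{int}(F))$), with $0=\emptyset$, $1=X$, $F^*=\mathrm{cl}(X\setminus F)$, $F\vee G=F\cup G$, $F\wedge G=\mathrm{cl}(\mathrm{int}(F\cap G))$; $CR(X)$ is the set of compact regular closed subsets; and $\rho_X$ is the relation on $RC(X)$ given by $F\rho_XG$ iff $F\cap G\neq\emptyset$. A normal contact relation on a Boolean algebra $B$ is a binary relation $C$ on $B$ such that: (C1) $a\ne 0$ implies $aCa$; (C2) $aCb$ implies $a\neq 0$ and $b\ne 0$; (C3) $aCb$ implies $bCa$; (C4) $aC(b\vee c)$ iff $aCb$ or $aCc$; (C5) if not $aCb$, then there is $c\in B$ with not $aCc$ and not $bCc^*$; (C6) if $a\neq 1$ then there is $b\neq 0$ with not $bCa$. $\mathcal{K}(X)$ is the set of all Hausdorff compactifications $(Y,f)$ of $X$ ($Y$ compact Hausdorff, $f:X\to Y$ a homeomorphic embedding with dense image) up to equivalence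 ($(Y_1,f_1)\sim(Y_2,f_2)$ iff there is a homeomorphism $h:Y_1\to Y_2$ with $h\circ f_1=f_2$), ordered by $[(Y_1,f_1)]\le[(Y_2,f_2)]$ iff there is a continuous $h:Y_2\to Y_1$ with $f_1=h\circ f_2$. *)

(* Defs.v *)
From HB Require Import structures.
From mathcomp Require Import all_boot all_order all_classical topology.
From Stdlib Require Relation_Definitions.

Set Implicit Arguments.
Unset Strict Implicit.
Unset Printing Implicit Defensive.

Import Order.TTheory.
Local Open Scope classical_set_scope.

Record RC (X : topologicalType) : Type := MkRC {
  rc_set :> set X;
  rc_regclosed : regclosed rc_set
}.

Lemma rc_eq (X : topologicalType) (F G : RC X) : rc_set F = rc_set G -> F = G.
Proof.
case: F G => [F hF] [G hG] /= E; case: _ / E hG => hG.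
by congr MkRC; exact: Prop_irrelevance.
Qed.

Lemma rc_closed (X : topologicalType) (F : RC X) : closed F.
Proof. rewrite -(rc_regclosed F); exact: closed_closure. Qed.
Arguments rc_closed {X} F.

Lemma regclosed_set0 (X : topologicalType) : regclosed (@set0 X).
Proof. by rewrite /regclosed interior0 closure0. Qed.

Lemma regclosed_setT (X : topologicalType) : regclosed [set: X].
Proof. by rewrite /regclosed interiorT closureT. Qed.

Lemma regclosed_closure_interior (X : topologicalType) (A : set X) :
  regclosed (closure A°).
Proof. exact/closure_open_regclosed/open_interior. Qed.

Lemma regclosed_closureC (X : topologicalType) (F : RC X) :
  regclosed (closure (~` F)).
Proof. exact/closure_open_regclosed/closed_openC/rc_closed. Qed.

Lemma closure_interior_closed (X : topologicalType) (A : set X) :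
  closed A -> closure A° `<=` A.
Proof.
move=> /closure_id cA; rewrite [X in _ `<=` X]cA.
by apply: closureS; exact: interior_subset.
Qed.

Lemma regclosed_setU (X : topologicalType) (F G : RC X) : regclosed (F `|` G).
Proof.
rewrite /regclosed eqEsubset; split.
  by apply: closure_interior_closed; apply: closedU; exact: rc_closed.
rewrite -{1}(rc_regclosed F) -{1}(rc_regclosed G) -closureU.
by apply: closureS; exact: interiorU.
Qed.

Definition rc_bot (X : topologicalType) : RC X := MkRC (@regclosed_set0 X).
Definition rc_top (X : topologicalType) : RC X := MkRC (@regclosed_setT X).
Definition rc_join (X : topologicalType) (F G : RC X) : RC X :=
  MkRC (regclosed_setU F G).
Definition rc_meet (X : topologicalType) (F G : RC X) : RC X :=
  MkRC (regclosed_closure_interior (F `&` G)).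
Definition rc_compl (X : topologicalType) (F : RC X) : RC X :=
  MkRC (regclosed_closureC F).
Definition rc_le (X : topologicalType) (F G : RC X) : bool := `[< F `<=` G >].

Lemma rc_le_refl (X : topologicalType) : reflexive (@rc_le X).
Proof. by move=> F; apply/asboolP. Qed.

Lemma rc_le_anti (X : topologicalType) : antisymmetric (@rc_le X).
Proof.
by move=> F G /andP[/asboolP FG /asboolP GF]; apply/rc_eq; rewrite eqEsubset.
Qed.

Lemma rc_le_trans (X : topologicalType) : transitive (@rc_le X).
Proof.
move=> G F H /asboolP FG /asboolP GH; apply/asboolP.
exact: subset_trans FG GH.
Qed.

Fact rc_display : Order.disp_t. Proof. exact: Order.Disp tt tt. Qed.

HB.instance Definition _ (X : topologicalType) := gen_eqMixin (RC X).
HB.instance Definition _ (X : topologicalType) := gen_choiceMixin (RC X).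
HB.instance Definition _ (X : topologicalType) :=
  @Order.Le_isPOrder.Build rc_display (RC X) (@rc_le X)
    (@rc_le_refl X) (@rc_le_anti X) (@rc_le_trans X).

Lemma rc_leP (X : topologicalType) (F G : RC X) :
  reflect (F `<=` G) (F <= G)%O.
Proof. exact: asboolP. Qed.

Lemma rc_lexI (X : topologicalType) (F G H : RC X) :
  (F <= rc_meet G H)%O = (F <= G)%O && (F <= H)%O.
Proof.
apply/rc_leP/andP => [FGH|[/rc_leP FG /rc_leP FH]].
  have GH : closure (G `&` H)° `<=` G `&` H.
    by apply: closure_interior_closed; apply: closedI; exact: rc_closed.
  by split; apply/rc_leP => x /FGH/GH[].
rewrite -(rc_regclosed F); apply: closureS; apply: interiorS => x Fx.
by split; [exact: FG | exact: FH].
Qed.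

Lemma rc_leUx (X : topologicalType) (F G H : RC X) :
  (rc_join F G <= H)%O = (F <= H)%O && (G <= H)%O.
Proof.
apply/rc_leP/andP => [FGH|[/rc_leP FH /rc_leP GH] x [/FH|/GH]//].
by split; apply/rc_leP => x Hx; apply: FGH; [left | right].
Qed.

HB.instance Definition _ (X : topologicalType) :=
  @Order.POrder_isMeetSemilattice.Build rc_display (RC X)
    (@rc_meet X) (@rc_lexI X).
HB.instance Definition _ (X : topologicalType) :=
  @Order.POrder_isJoinSemilattice.Build rc_display (RC X)
    (@rc_join X) (@rc_leUx X).

Lemma interior_setU_closed (X : topologicalType) (A B : set X) :
  closed A -> (A `|` B)° `<=` closure A° `|` closure B°.
Proof.
move=> cA x ABx; apply: contrapT => /not_orP[nA nB].
have : (~` closure A° `&` ~` closure B° `&` (A `|` B)°) x by [].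
set U := (X in X x -> _) => Ux.
have oU : open U.
  apply: openI; last exact: open_interior.
  by apply: openI; apply: closed_openC; exact: closed_closure.
have UA : U `<=` A.
  move=> y Uy; apply: contrapT => nAy.
  have : (B°) y.
    have oV : open (U `&` ~` A) by apply: openI => //; exact: closed_openC.
    have : (U `&` ~` A) `<=` B.
      by move=> z [[_ /interior_subset[Az|//]] nAz]; case: (nAz).
    by rewrite open_subsetE// => /(_ y); apply.
  by move/(@subset_closure _ _); case: Uy => -[].
have /subset_closure : (A°) x by move: UA; rewrite open_subsetE// => /(_ x); apply.
exact: nA.
Qed.

Lemma rc_meetUl (X : topologicalType) :
  @left_distributive (RC X) (RC X) Order.meet Order.join.
Proof.
move=> F G H; apply: le_anti; apply/andP; split; last first.
  by rewrite leUx; apply/andP; split; apply: leI2 => //; rewrite ?leUl ?leUr.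
apply/rc_leP; rewrite [X in X `<=` _]/= setIUl.
set RHS := (X in _ `<=` X).
have /closure_id -> : closed RHS by exact: rc_closed.
by apply: closureS; apply: interior_setU_closed; apply: closedI; exact: rc_closed.
Qed.

HB.instance Definition _ (X : topologicalType) :=
  Order.Lattice_Meet_isDistrLattice.Build rc_display (RC X) (@rc_meetUl X).

Lemma rc_le0x (X : topologicalType) (F : RC X) : (rc_bot X <= F)%O.
Proof. by apply/rc_leP; exact: sub0set. Qed.

Lemma rc_lex1 (X : topologicalType) (F : RC X) : (F <= rc_top X)%O.
Proof. by apply/rc_leP; exact: subsetT. Qed.

HB.instance Definition _ (X : topologicalType) :=
  @Order.hasBottom.Build rc_display (RC X) (rc_bot X) (@rc_le0x X).
HB.instance Definition _ (X : topologicalType) :=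
  @Order.hasTop.Build rc_display (RC X) (rc_top X) (@rc_lex1 X).

Lemma rc_joinxC (X : topologicalType) (F : RC X) :
  (F `|` rc_compl F)%O = \top%O.
Proof.
apply/rc_eq; rewrite eqEsubset; split=> // x _ /=.
by have [Fx|nFx] := pselect (rc_set F x); [left | right; exact: subset_closure].
Qed.

Lemma rc_meetxC (X : topologicalType) (F : RC X) :
  (F `&` rc_compl F)%O = \bot%O.
Proof.
apply/rc_eq => /=; rewrite interiorI closure_setC.
have -> : (~` F°)° = ~` F by rewrite interiorC (rc_regclosed F).
rewrite (_ : _ `&` _ = set0) ?closure0//.
by rewrite -subset0 => x [/interior_subset].
Qed.

HB.instance Definition _ (X : topologicalType) :=
  @Order.TBDistrLattice_hasComplement.Build rc_display (RC X)
    (@rc_compl X) (@rc_joinxC X) (@rc_meetxC X).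

Lemma rc_set_bot (X : topologicalType) : (\bot%O : RC X) = set0 :> set X.
Proof. by []. Qed.
Lemma rc_set_top (X : topologicalType) : (\top%O : RC X) = setT :> set X.
Proof. by []. Qed.
Lemma rc_set_join (X : topologicalType) (F G : RC X) :
  (F `|` G)%O = F `|` G :> set X.
Proof. by []. Qed.
Lemma rc_set_meet (X : topologicalType) (F G : RC X) :
  (F `&` G)%O = closure (F `&` G)° :> set X.
Proof. by []. Qed.
Lemma rc_set_compl (X : topologicalType) (F : RC X) :
  (~` F)%O = closure (~` F) :> set X.
Proof. by []. Qed.

Definition CR (X : topologicalType) : set (RC X) := [set F : RC X | compact F].
Arguments CR X _ : clear implicits.

Definition rho (X : topologicalType) (F G : RC X) : Prop := F `&` G !=set0.

(* [ctbDistrLatticeType] is the library's structure of Boolean algebras; the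
   one-element algebra is included. *)
Record normal_contact (d : Order.disp_t) (B : ctbDistrLatticeType d)
    (C : B -> B -> Prop) : Prop := NormalContact {
  normal_contact1 : forall a, a <> \bot%O -> C a a;
  normal_contact2 : forall a b, C a b -> a <> \bot%O /\ b <> \bot%O;
  normal_contact3 : forall a b, C a b -> C b a;
  normal_contact4 : forall a b c, C a (b `|` c)%O <-> C a b \/ C a c;
  normal_contact5 : forall a b, ~ C a b -> exists c, ~ C a c /\ ~ C b (~` c)%O;
  normal_contact6 : forall a, a <> \top%O -> exists b, b <> \bot%O /\ ~ C b a
}.

(* [porderType] cannot be used for the compactifications of a space: its
   carriers live in a universe strictly below that of [topologicalType], while
   a compactification carries an arbitrary [topologicalType]. *)
Record poset : Type := Poset {
  poset_car :> Type;
  poset_le : poset_car -> poset_car -> Prop;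
  poset_order : Relation_Definitions.order poset_car poset_le
}.

Definition poset_isomorphism (P Q : poset) (f : P -> Q) : Prop :=
  bijective f /\ forall x y, poset_le x y <-> poset_le (f x) (f y).

Definition homeomorphism (S T : topologicalType) (h : S -> T) : Prop :=
  continuous h /\
  exists g : T -> S, [/\ cancel h g, cancel g h & continuous g].

Definition homeomorphic_embedding (S T : topologicalType) (f : S -> T) : Prop :=
  [/\ injective f, continuous f &
      forall U : set S, open U ->
        exists2 V : set T, open V & f @` U = V `&` range f].

Record compactification (X : topologicalType) : Type := Compactification {
  cpt_space :> topologicalType;
  cpt_map : X -> cpt_space;
  cpt_compact : compact [set: cpt_space];
  cpt_hausdorff : hausdorff_space cpt_space;
  cpt_embedding : homeomorphic_embedding cpt_map;
  cpt_dense : dense (range cpt_map)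
}.

Definition cpt_equiv (X : topologicalType) (c1 c2 : compactification X) : Prop :=
  exists h : c1 -> c2, homeomorphism h /\ h \o cpt_map c1 = cpt_map c2.

Definition cpt_le (X : topologicalType) (c1 c2 : compactification X) : Prop :=
  exists h : c2 -> c1, continuous h /\ cpt_map c1 = h \o cpt_map c2.

Lemma comp_continuous (R S T : topologicalType) (f : R -> S) (g : S -> T) :
  continuous f -> continuous g -> continuous (g \o f).
Proof.
by move=> cf cg x; apply: continuous_comp; [exact: cf | exact: cg].
Qed.

Lemma cpt_equiv_refl (X : topologicalType) (c : compactification X) :
  cpt_equiv c c.
Proof.
exists id; split=> //; split; first by move=> ?.
by exists id; split=> // ?.
Qed.

Lemma cpt_equiv_sym (X : topologicalType) (c1 c2 : compactification X) :
  cpt_equiv c1 c2 -> cpt_equiv c2 c1.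
Proof.
move=> [h [[ch [g [hg gh cg]]] hf]]; exists g; split.
  by split=> //; exists h.
by rewrite -hf; apply/funext => x /=; rewrite hg.
Qed.

Lemma cpt_equiv_trans (X : topologicalType) (c1 c2 c3 : compactification X) :
  cpt_equiv c1 c2 -> cpt_equiv c2 c3 -> cpt_equiv c1 c3.
Proof.
move=> [h [[ch [g [hg gh cg]]] hf]] [k [[ck [l [kl lk cl]]] kf]].
exists (k \o h); split; last by rewrite -kf -hf.
split; first exact: comp_continuous.
exists (g \o l); split.
- exact: can_comp.
- exact: can_comp.
- exact: comp_continuous.
Qed.

Lemma cpt_equiv_le (X : topologicalType) (c1 c2 : compactification X) :
  cpt_equiv c1 c2 -> cpt_le c1 c2.
Proof.
by move=> /cpt_equiv_sym[h [[ch _] hf]]; exists h.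
Qed.

Lemma cpt_le_trans (X : topologicalType) (c1 c2 c3 : compactification X) :
  cpt_le c1 c2 -> cpt_le c2 c3 -> cpt_le c1 c3.
Proof.
move=> [h [ch hf]] [k [ck kf]]; exists (h \o k); split.
  exact: comp_continuous.
by rewrite hf kf.
Qed.

Lemma cpt_map_fixed (X : topologicalType) (c : compactification X)
    (h : c -> c) : continuous h -> h \o cpt_map c = cpt_map c -> h = id.
Proof.
move=> ch hf; apply/funext => y; apply/eqP; apply: contraT => hy.
have := @cpt_hausdorff _ c; rewrite open_hausdorff => /(_ _ _ hy).
move=> [[A B] /= [/set_mem Ahy /set_mem By] [oA oB /eqP AB0]].
have oO : open (h @^-1` A `&` B).
  by apply: openI => //; apply: open_comp => // x _; exact: ch.
have [|z [[Ahz Bz] [x _ xz]]] := @cpt_dense _ c _ _ oO; first by exists y.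
have : (A `&` B) z.
  by split=> //; rewrite -xz -[cpt_map c x](congr1 (@^~ x) hf) /= xz.
by rewrite AB0.
Qed.

Lemma cpt_le_anti (X : topologicalType) (c1 c2 : compactification X) :
  cpt_le c1 c2 -> cpt_le c2 c1 -> cpt_equiv c1 c2.
Proof.
move=> [h [ch hf]] [k [ck kf]]; exists k; split=> //; split=> //.
exists h; split=> //.
- have E : h \o k = id.
    apply: (@cpt_map_fixed X c1); last by rewrite -compA -kf -hf.
    exact: comp_continuous.
  by move=> x; exact: (congr1 (fun u => u x) E).
- have E : k \o h = id.
    apply: (@cpt_map_fixed X c2); last by rewrite -compA -hf -kf.
    exact: comp_continuous.
  by move=> x; exact: (congr1 (fun u => u x) E).
Qed.

Definition cpt_classes (X : topologicalType) : Type :=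
  {S : compactification X -> Prop | exists c, S = cpt_equiv c}.

Definition cpt_class (X : topologicalType) (c : compactification X) :
  cpt_classes X := exist _ (cpt_equiv c) (ex_intro _ c erefl).

Definition cpt_classes_le (X : topologicalType) (S1 S2 : cpt_classes X) : Prop :=
  exists c1 c2, [/\ S1 = cpt_class c1, S2 = cpt_class c2 & cpt_le c1 c2].

Lemma cpt_class_eq (X : topologicalType) (c1 c2 : compactification X) :
  cpt_class c1 = cpt_class c2 <-> cpt_equiv c1 c2.
Proof.
split=> [/(congr1 sval)/= ->|c12]; first exact: cpt_equiv_refl.
apply: eq_exist => /=; apply/funext => c; apply/propext; split.
  exact/cpt_equiv_trans/cpt_equiv_sym.
exact: cpt_equiv_trans.
Qed.

Lemma cpt_class_surj (X : topologicalType) (S : cpt_classes X) :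
  exists c, S = cpt_class c.
Proof. by case: S => S [c Sc]; exists c; exact: eq_exist. Qed.

Lemma cpt_class_le (X : topologicalType) (c1 c2 : compactification X) :
  cpt_classes_le (cpt_class c1) (cpt_class c2) <-> cpt_le c1 c2.
Proof.
split=> [[d1 [d2 [/cpt_class_eq e1 /cpt_class_eq e2 d12]]]|c12]; last first.
  by exists c1, c2.
apply: cpt_le_trans (cpt_equiv_le e1) _; apply: cpt_le_trans d12 _.
exact/cpt_equiv_le/cpt_equiv_sym.
Qed.

Lemma cpt_classes_order (X : topologicalType) :
  Relation_Definitions.order (cpt_classes X) (@cpt_classes_le X).
Proof.
split.
- move=> S; have [c ->] := cpt_class_surj S.
  exact/cpt_class_le/cpt_equiv_le/cpt_equiv_refl.
- move=> S1 S2 S3; have [c1 ->] := cpt_class_surj S1.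
  have [c2 ->] := cpt_class_surj S2; have [c3 ->] := cpt_class_surj S3.
  move=> /cpt_class_le c12 /cpt_class_le c23; apply/cpt_class_le.
  exact: cpt_le_trans c12 c23.
- move=> S1 S2; have [c1 ->] := cpt_class_surj S1.
  have [c2 ->] := cpt_class_surj S2.
  move=> /cpt_class_le c12 /cpt_class_le c21; apply/cpt_class_eq.
  exact: cpt_le_anti.
Qed.

Definition K (X : topologicalType) : poset := Poset (@cpt_classes_order X).

Record admissible_contact (X : topologicalType) (C : RC X -> RC X -> Prop) :
    Prop := AdmissibleContact {
  admissible_normal : normal_contact C;
  admissible_RC1 : forall a b, rho a b -> C a b;
  admissible_RC2 : forall a b, CR X b -> C a b -> rho a b
}.

Definition Ka_car (X : topologicalType) : Type :=
  {C : RC X -> RC X -> Prop | admissible_contact C}.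

Definition Ka_le (X : topologicalType) (C1 C2 : Ka_car X) : Prop :=
  forall a b, sval C2 a b -> sval C1 a b.

Lemma Ka_order (X : topologicalType) : Relation_Definitions.order (Ka_car X) (@Ka_le X).
Proof.
split.
- by move=> C a b.
- by move=> C1 C2 C3 h12 h23 a b /h23/h12.
- move=> [C1 h1] [C2 h2] h12 h21; apply: eq_exist.
  apply/funext => a; apply/funext => b; apply/propext.
  by split; [exact: h21 | exact: h12].
Qed.

Definition Ka (X : topologicalType) : poset := Poset (@Ka_order X).

(* Main.v *)
From HB Require Import structures.
Require Import Defs.
From mathcomp Require Import all_boot all_order all_classical topology.

Set Implicit Arguments.
Unset Strict Implicit.
Unset Printing Implicit Defensive.

Import Order.Theory.
Local Open Scope classical_set_scope.

(** A compactification [c] of [X], with embedding [f], gives the relation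
    [cpt_contact c] on regular closed sets: [a] and [b] are in contact when
    the closures of [f @` a] and [f @` b] in [c] meet.  This induces the
    isomorphism.

    It is admissible: (C5) is the normality of the compact Hausdorff space [c],
    transported back to [X] along [f]; (RC2) holds because the image of a
    compact set is already closed in [c] and [f] is an embedding; (C6) follows
    from (RC2), as [X] has enough compact regular closed sets.

    The order is preserved because a continuous map sends adherent points to
    adherent points.  It is reflected by an extension theorem of Taimanov type
    ([dense_extension]): a map from a dense set into a compact Hausdorff space
    extends continuously as soon as the preimages of sets with disjoint
    closures have disjoint closures, and regular closed sets suffice to test
    this.  In particular [c] is determined by its contact relation up to
    equivalence.

    Every admissible [C] arises in this way.  The compactification is the space
    of clusters of [C], that is, of the maximal pairwise related sets of regular
    closed sets that behave like the set of all regular closed sets containing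
    a point.  It is compact and Hausdorff for any normal contact relation on
    any Boolean algebra.  A point of [X] is sent to the cluster of the regular
    closed sets containing it; (RC1), (RC2) and local compactness make this a
    cluster.  The closure of the image of [a] consists of the clusters
    containing [a], so the contact relation of the cluster space is the
    relation of belonging to a common cluster, and two sets in [C]-contact do
    belong to a common cluster ([contact_cluster_ex]). *)

(** * Clusters of a normal contact relation *)

Section contact_algebra.
Context {d : Order.disp_t} {B : ctbDistrLatticeType d}.

(** The model is the set of all [a] whose closures contain a fixed point of a
    compactification: it is a grill (first two fields), and by normality it
    is maximal among the sets of pairwise related elements. *)
Record contact_cluster (C : B -> B -> Prop) (s : set B) : Prop :=
  ContactCluster {
    cluster_bot : ~ s \bot%O;
    cluster_join : forall a b, s (a `|` b)%O <-> s a \/ s b;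
    cluster_max : forall a, s a <-> forall b, s b -> C a b
  }.

Definition cluster_space (C : B -> B -> Prop) : Type :=
  {s : set B | contact_cluster C s}.

Section topology.
Context (C : B -> B -> Prop).
Implicit Types (s t : cluster_space C).

HB.instance Definition _ := gen_eqMixin (cluster_space C).
HB.instance Definition _ := gen_choiceMixin (cluster_space C).

(** The sets of clusters containing a given [a] are a base of closed sets: by
    [cluster_join] they are stable under finite unions. *)
Definition cluster_open (U : set (cluster_space C)) : Prop :=
  forall s, U s ->
    exists2 a, ~ sval s a & [set t : cluster_space C | ~ sval t a] `<=` U.

Lemma cluster_openT : cluster_open setT.
Proof. by move=> s _; exists \bot%O => //; exact: cluster_bot (svalP s). Qed.

Lemma cluster_openI : setI_closed cluster_open.
Proof.
move=> U V oU oV s [/oU[a sa aU] /oV[b sb bV]]; exists (a `|` b)%O.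
  by move=> /(cluster_join (svalP s))[].
move=> t /= tab; split; [apply: aU | apply: bV] => /= tx; apply: tab.
  by apply/(cluster_join (svalP t)); left.
by apply/(cluster_join (svalP t)); right.
Qed.

Lemma cluster_open_bigU (I : Type) (f : I -> set (cluster_space C)) :
  (forall i, cluster_open (f i)) -> cluster_open (\bigcup_i f i).
Proof.
move=> of_ s [i _ /of_[a sa af]]; exists a => //.
by move=> t ta; exists i => //; exact: af.
Qed.

HB.instance Definition _ := isOpenTopological.Build (cluster_space C)
  cluster_openT cluster_openI cluster_open_bigU.

Lemma cluster_openE (U : set (cluster_space C)) : open U = cluster_open U.
Proof. by []. Qed.

Lemma cluster_ext s t : (forall a, sval s a <-> sval t a) -> s = t.
Proof.
case: s t => [s hs] [t ht] /= st; apply: eq_exist.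
by apply/funext => a; apply/propext.
Qed.

Lemma closed_mem_cluster (a : B) : closed [set s : cluster_space C | sval s a].
Proof.
rewrite -openC cluster_openE => s /= sa; exists a => //.
Qed.

End topology.

Section normal.
Context {C : B -> B -> Prop} (nC : normal_contact C).
Implicit Types (a b c e : B) (s t : cluster_space C).

Lemma contact_le2 a b a' b' : (a <= a')%O -> (b <= b')%O -> C a b -> C a' b'.
Proof.
have mono x y z : (y <= z)%O -> C x y -> C x z.
  by move=> /join_r <- xy; apply/(normal_contact4 nC); left.
move=> aa' bb' /(mono _ _ _ bb')/(normal_contact3 nC)/(mono _ _ _ aa').
exact: normal_contact3.
Qed.

Lemma contact_joinl a b c : C (a `|` b)%O c -> C a c \/ C b c.
Proof.
move=> /(normal_contact3 nC)/(normal_contact4 nC)[] /(normal_contact3 nC);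
  by [left | right].
Qed.

Lemma cluster_contact s a b : sval s a -> sval s b -> C a b.
Proof. by move=> /(cluster_max (svalP s)); exact. Qed.

Lemma cluster_le s a b : (a <= b)%O -> sval s a -> sval s b.
Proof.
by move=> /join_r <- sa; apply/(cluster_join (svalP s)); left.
Qed.

Lemma cluster_compl s a : sval s a \/ sval s (~` a)%O.
Proof.
apply/(cluster_join (svalP s)); rewrite joinxC.
apply/(cluster_max (svalP s)) => b sb.
apply: (@contact_le2 b b) => //.
apply: (normal_contact1 nC) => b0; apply: (cluster_bot (svalP s)).
by rewrite -b0.
Qed.

Lemma cluster_notinP s a : ~ sval s a -> exists2 b, sval s b & ~ C a b.
Proof.
move=> sa; apply: contrapT => nb; apply: sa.
apply/(cluster_max (svalP s)) => b sb; apply: contrapT => ab.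
by apply: nb; exists b.
Qed.

(** The form in which (C5) is used on clusters: the sets of clusters omitting
    [~` e] and omitting [e] are disjoint open sets; the first is a neighbourhood
    of [s], the second contains every cluster having [a] as an element. *)
Lemma cluster_separate s a : ~ sval s a ->
  exists2 e, ~ C a e & ~ sval s (~` e)%O.
Proof.
move=> /cluster_notinP[b sb /(normal_contact5 nC)[e [ae be]]].
by exists e => // se; apply: be; exact: cluster_contact sb se.
Qed.

Lemma cluster_space_hausdorff : hausdorff_space (cluster_space C).
Proof.
rewrite open_hausdorff => s t st.
wlog [a sa ta] : s t st / exists2 a, sval s a & ~ sval t a.
  move=> H; have [/H-/(_ st)//|nst] :=
    pselect (exists2 a, sval s a & ~ sval t a).
  have ts : t != s by rewrite eq_sym.
  have [|[U V] /= [Ut Vs] [oU oV UV]] := H t s ts.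
    apply: contrapT => nts; move/eqP: st; apply; apply: cluster_ext.
    move=> a; split=> xa; apply: contrapT => ya.
      by apply: nst; exists a.
    by apply: nts; exists a.
  by exists (V, U) => //; split=> //; rewrite setIC.
have [e ae te] := cluster_separate ta.
exists ([set u : cluster_space C | ~ sval u e],
        [set u : cluster_space C | ~ sval u (~` e)%O]) => /=.
  split; apply/mem_set => //= se; apply: ae; exact: cluster_contact sa se.
split; try exact/closed_openC/closed_mem_cluster.
apply/eqP; rewrite -subset0 => u [/= ue ue'].
by case: (cluster_compl u e).
Qed.

(** An ultrafilter [F] on clusters converges to the set [S] of all elements
    related to every member of [G], the set of those [a] that [F]-almost all
    clusters contain.  The set [G] is itself a grill of pairwise related
    elements, so (C5) makes its enlargement [S] a cluster; and [F] converges to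
    [S] because an element outside [S] is outside [G]. *)
Lemma cluster_space_compact : compact [set: cluster_space C].
Proof.
rewrite compact_ultra => F FU _.
pose G : set B := [set a | F [set s | sval s a]].
have GC a b : G a -> G b -> C a b.
  move=> Ga Gb; have /filter_ex[s [sa sb]] :
    F ([set s | sval s a] `&` [set s | sval s b]) by exact: filterI.
  exact: cluster_contact sa sb.
have notG a : ~ G a -> F [set s | ~ sval s a].
  move=> Ga.
  by case: (in_ultra_setVsetC [set s : cluster_space C | sval s a] FU).
have Gcompl a : ~ G a -> G (~` a)%O.
  move=> /notG; apply: filterS => s /= sa.
  by case: (cluster_compl s a).
pose S : set B := [set a | forall b, G b -> C a b].
have Ssep a : ~ S a -> exists2 e, ~ C a e & ~ G (~` e)%O.
  move=> Sa; have [b Gb ab] : exists2 b, G b & ~ C a b.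
    apply: contrapT => nb; apply: Sa => b Gb; apply: contrapT => ab.
    by apply: nb; exists b.
  have [e [ae be]] := normal_contact5 nC ab.
  by exists e => // Ge; apply: be; exact: GC.
have SC a b : S a -> S b -> C a b.
  move=> Sa Sb; apply: contrapT => /(normal_contact5 nC)[e [ae be]].
  have [Ge|/Gcompl Ge] := pselect (G e); first exact/ae/Sa.
  exact/be/Sb.
have GS : G `<=` S by move=> a Ga b; exact: GC.
have clS : contact_cluster C S.
  split.
  - move=> S0.
    by have [] := normal_contact2 nC (SC _ _ S0 S0).
  - move=> a b; split=> [Sab|].
      (* If neither [a] nor [b] is in [S], then [c] and [e], unrelated to [a]
         and [b], have complements outside [G]; so [c `&` e] is in [G], and it
         is unrelated to [a `|` b]. *)
      apply: contrapT => /not_orP[/Ssep[c ac Gc] /Ssep[e be Ge]].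
      have Gce : G (c `&` e)%O.
        apply: filterS (filterI (notG _ Gc) (notG _ Ge)) => s /= [sc se].
        case: (cluster_compl s (c `&` e)%O) => //.
        by rewrite complI => /(cluster_join (svalP s))[].
      have [abs|abs] := contact_joinl (Sab _ Gce).
        by apply: ac; apply: contact_le2 abs; rewrite ?leIl.
      by apply: be; apply: contact_le2 abs; rewrite ?leIr.
    by move=> [] Sx c /Sx; apply: contact_le2; rewrite ?leUl ?leUr.
  - move=> a; split=> [Sa b Sb|Sa b /GS]; [exact: SC | exact: Sa].
exists (exist _ S clS); split=> //= U; rewrite nbhsE => -[V [oV Vs] VU].
have [a /= Sa aV] := oV _ Vs; apply: filterS VU _; apply: filterS aV _.
by apply: notG => /GS.
Qed.

End normal.
End contact_algebra.

(** * Continuous extension from a dense set *)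

Lemma hausdorff_compact_disjoint_closures {Z : topologicalType} (z z' : Z) :
  compact [set: Z] -> hausdorff_space Z -> z != z' ->
  exists U V, [/\ open U, open V, U z, V z' & closure U `&` closure V = set0].
Proof.
move=> Zc Zh; have := Zh; rewrite open_hausdorff => /[apply].
move=> [[U V] /= [/set_mem Uz /set_mem Vz'] [oU oV /eqP UV]].
have [W Wz WU] := compact_regular Zh Zc (filterT : nbhs z setT)
  (open_nbhs_nbhs (conj oU Uz)).
exists W°, V; split=> //; first exact: open_interior.
rewrite -subset0 => y [/(closureS (@interior_subset _ W))/WU Uy clVy].
have [w [Vw Uw]] := clVy _ (open_nbhs_nbhs (conj oU Uy)).
by have : (U `&` V) w by []; rewrite UV.
Qed.

Section dense_extension.
Context {X : Type} {Y Z : topologicalType} (e : X -> Y) (f : X -> Z).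
Hypotheses (e_dense : dense (range e)).
Hypotheses (Zc : compact [set: Z]) (Zh : hausdorff_space Z).

(** The images by [f] of the traces on [X] of the neighbourhoods of [y]; the
    value of the extension at [y] is the limit of this filter. *)
Definition trace_filter (y : Y) : set_system Z :=
  filter_from (nbhs y) (fun W => f @` (e @^-1` W)).

Lemma trace_filter_proper y : ProperFilter (trace_filter y).
Proof.
apply: filter_from_proper.
  apply: filter_from_filter; first by exists setT; exact: filterT.
  move=> V W yV yW; exists (V `&` W); first exact: filterI.
  by move=> _ [x [Vx Wx] <-]; split; exists x.
move=> W; rewrite nbhsE => -[V [oV Vy] VW].
have [|z [Vz [x _ exz]]] := e_dense _ oV; first by exists y.
by exists (f x), x => //; apply: VW; rewrite /= exz.
Qed.

(** Two distinct adherent points of a trace filter at [y] would have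
    neighbourhoods with disjoint closures whose preimages are both adherent to
    [y]; so by compactness the filter converges. *)
Lemma dense_extension :
  (forall U V : set Z, open U -> open V -> closure U `&` closure V = set0 ->
    closure (e @` (f @^-1` U)) `&` closure (e @` (f @^-1` V)) = set0) ->
  exists h : Y -> Z, continuous h /\ f = h \o e.
Proof.
move=> sep.
have cluster_unique y z z' :
    cluster (trace_filter y) z -> cluster (trace_filter y) z' -> z = z'.
  move=> yz yz'; apply/eqP; apply: contraT.
  move=> /(hausdorff_compact_disjoint_closures Zc Zh).
  move=> [U [V [oU oV Uz Vz' /(sep _ _ oU oV) UV]]].
  have adh O t : open O -> O t -> cluster (trace_filter y) t ->
      closure (e @` (f @^-1` O)) y.
    move=> oO Ot yt W yW.
    have [|_ [[x Wx <-] Ox]] := yt (f @` (e @^-1` W)) O _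
      (open_nbhs_nbhs (conj oO Ot)); first by exists W.
    by exists (e x); split=> //; exists x.
  have : (closure (e @` (f @^-1` U)) `&` closure (e @` (f @^-1` V))) y.
    by split; [exact: (adh _ z) | exact: (adh _ z')].
  by rewrite UV.
have /choice[h yh] : forall y, exists z, cluster (trace_filter y) z.
  move=> y; have PF := trace_filter_proper y.
  by have [z [_ yz]] := Zc PF filterT; exists z.
have h_lim y : trace_filter y --> h y.
  have PF := trace_filter_proper y.
  apply: (compact_cluster_set1 Zh Zc) => //; [exact: filterT|exact: filterT|].
  by apply/seteqP; split=> [z yz|_ ->//]; exact: cluster_unique yz (yh y).
exists h; split; last first.
  apply/funext => x; apply: (cluster_unique (e x)) => //=.
  move=> A O [W exW WA] /nbhs_singleton Ofx; exists (f x); split=> //.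
  by apply: WA; exists x => //; exact: nbhs_singleton exW.
(* Continuity: if [f] maps the trace of an open [W'] into [V], then [h] maps
   [W'] into [closure V], so a neighbourhood [V] of [h y] with closure inside
   [O] is needed. *)
move=> y O /(compact_regular Zh Zc (filterT : nbhs (h y) setT))[V hyV VO].
have [W yW WV] := h_lim y V hyV.
rewrite /= nbhs_simpl; move: yW; rewrite nbhsE => -[W' [oW' W'y] W'W].
exists W'; first by [].
move=> y' W'y'; apply: VO => P hy'P.
have hW' : trace_filter y' (f @` (e @^-1` W')).
  by exists W' => //; exact: open_nbhs_nbhs.
have [_ [[x W'x <-] Px]] := yh y' _ _ hW' hy'P.
by exists (f x); split=> //; apply: WV; exists x => //; exact: W'W.
Qed.

End dense_extension.

(** * The contact relation of a compactification *)

Section contact_of_compactification.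
Context {X : topologicalType}.

Lemma compact_rc_nbhs (x : X) (U : set X) :
  locally_compact [set: X] -> hausdorff_space X -> open U -> U x ->
  exists b : RC X, [/\ CR X b, (rc_set b)° x & b `<=` U].
Proof.
move=> Xlc Xh oU Ux; have [K wK [Kc Kcl]] := Xlc x I.
have xK : nbhs x K by move: wK; rewrite /within /=; apply: filterS => y; exact.
have [V xV VUK] := compact_regular Xh Kc xK
  (filterI (open_nbhs_nbhs (conj oU Ux)) xK).
exists (MkRC (regclosed_closure_interior V)).
have VV : closure V° `<=` closure V by apply: closureS; exact: interior_subset.
split=> /=.
- apply: (subclosed_compact _ Kc); first exact: closed_closure.
  by move=> y /VV/VUK[].
- by apply: (interiorS (@subset_closure _ V°)); exact: nbhs_interior.
- by move=> y /VV/VUK[].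
Qed.

Lemma closure_image_setC {Y : topologicalType} (f : X -> Y)
    (a : set X) (U : set Y) :
  open U -> a `<=` f @^-1` (~` U) -> closure (f @` a) `<=` ~` U.
Proof.
move=> oU aU; have /closure_id -> : closed (~` U) by exact: open_closedC.
by apply: closureS => _ [x ax <-]; exact: aU.
Qed.

Lemma embedding_closure_preimage {Y : topologicalType} (f : X -> Y)
    (a : set X) :
  homeomorphic_embedding f -> closed a -> f @^-1` closure (f @` a) = a.
Proof.
move=> [finj _ fopen] cla; apply/seteqP; split=> x; last first.
  by move=> ax; apply: subset_closure; exists x.
move=> /= clfx; apply: contrapT => nax.
have [V oV VE] := fopen _ (closed_openC cla).
have [Vfx _] : (V `&` range f) (f x) by rewrite -VE; exists x.
have [_ [[z az <-] Vfz]] := clfx _ (open_nbhs_nbhs (conj oV Vfx)).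
have [w naw /finj wz] : (f @` (~` a)) (f z) by rewrite VE; split=> //; exists z.
by apply: naw; rewrite wz.
Qed.

Lemma closure_image_preimage {Y : topologicalType} (f : X -> Y) (U : set Y) :
  continuous f -> closure (f @` closure (f @^-1` U)) `<=` closure U.
Proof.
move=> fc; have /closure_id E : closed (closure U) by exact: closed_closure.
rewrite [X in _ `<=` X]E; apply: closureS => _ [x Ux <-] V fV.
by have [z [Uz Vz]] := Ux _ (fc x V fV); exists (f z).
Qed.

Definition cpt_contact (c : compactification X) (a b : RC X) : Prop :=
  closure (cpt_map c @` a) `&` closure (cpt_map c @` b) !=set0.

Lemma rc_nonempty (a : RC X) : a <> \bot%O -> exists x, rc_set a x.
Proof.
move=> a0; apply: contrapT => na; apply: a0; apply: rc_eq.
by rewrite rc_set_bot -subset0 => x ax; apply: na; exists x.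
Qed.

Lemma rc_proper (a : RC X) : a <> \top%O -> exists x, ~ rc_set a x.
Proof.
move=> aT; apply: contrapT => na; apply: aT; apply: rc_eq.
rewrite rc_set_top -subTset => x _; apply: contrapT => ax; apply: na.
by exists x.
Qed.

Lemma cpt_contact_rho (c : compactification X) a b :
  rho a b -> cpt_contact c a b.
Proof.
by move=> [x [ax bx]]; exists (cpt_map c x); split; apply: subset_closure;
  exists x.
Qed.

Lemma cpt_contact_compact (c : compactification X) a b :
  CR X b -> cpt_contact c a b -> rho a b.
Proof.
move=> bc [y []]; have [_ fc _] := cpt_embedding c.
have /closure_id <- : closed (cpt_map c @` b).
  apply: compact_closed; first exact: cpt_hausdorff.
  by apply: continuous_compact bc; exact: continuous_subspaceT.
move=> /[swap] -[x bx <-] ax; exists x; split=> //.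
by rewrite -(embedding_closure_preimage (cpt_embedding c) (rc_closed a)).
Qed.

(** (C5) for a compactification: normality gives an open [U] around the closure
    of [f @` a] whose closure misses the closure of [f @` b], and the closure of
    [f @^-1` U] in [X] has the complement sought. *)
Lemma cpt_contact_interpolate (c : compactification X) a b :
  ~ cpt_contact c a b ->
  exists e, ~ cpt_contact c a e /\ ~ cpt_contact c b (~` e)%O.
Proof.
set f := cpt_map c => ab; have [_ fc _] := cpt_embedding c.
pose clf (a : RC X) := closure (f @` a).
have nbhs_a : set_nbhs (clf a) (~` clf b).
  apply/set_nbhsP; exists (~` clf b); split=> //.
    exact/closed_openC/closed_closure.
  by move=> y ay by_; apply: ab; exists y.
have [V /set_nbhsP[U [oU aU UV]] Vb] :=
  compact_normal (@cpt_hausdorff _ c) (@cpt_compact _ c) (@closed_closure _ _)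
    nbhs_a.
have oW : open (f @^-1` U) by move/continuousP: fc; exact.
pose e : RC X := MkRC (closure_open_regclosed oW).
exists (~` e)%O; rewrite complK; split=> -[y [ay ey]].
  apply: (closure_image_setC oU _ ey (aU _ ay)).
  rewrite rc_set_compl; have /closure_id -> : closed (f @^-1` (~` U)).
    by move/continuous_closedP: fc; apply; exact: open_closedC.
  by apply: closureS => x ex Ux; apply: ex; exact: subset_closure.
by have /Vb := closureS UV (closure_image_preimage fc ey).
Qed.

Lemma cpt_contact_admissible (c : compactification X) :
  locally_compact [set: X] -> hausdorff_space X ->
  admissible_contact (cpt_contact c).
Proof.
move=> Xlc Xh; split; [split|exact: cpt_contact_rho|].
- move=> a /rc_nonempty[x ax]; apply: cpt_contact_rho; by exists x.
- move=> a b [y [ya yb]].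
  by split=> ab; [move: ya|move: yb]; rewrite ab rc_set_bot image_set0 closure0.
- by move=> a b [y [ya yb]]; exists y.
- move=> a b e; rewrite /cpt_contact rc_set_join image_setU closureU setIUr.
  split=> [[y [?|?]]|[] [y ?]]; [left|right| |];
    exists y=> //; [left|right] => //.
- exact: cpt_contact_interpolate.
- move=> a /rc_proper[x ax].
  have [b [bc bx ba]] := compact_rc_nbhs Xlc Xh (closed_openC (rc_closed a)) ax.
  exists b; split=> [b0|ab].
    by move: bx => /interior_subset; rewrite b0.
  have [z [az bz]] : rho a b.
    apply: cpt_contact_compact bc _ => //; case: ab => y [? ?]; by exists y.
  exact: ba bz az.
- by move=> a b; exact: cpt_contact_compact.
Qed.

Lemma cpt_contact_le (c1 c2 : compactification X) :
  cpt_le c1 c2 -> forall a b, cpt_contact c2 a b -> cpt_contact c1 a b.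
Proof.
move=> [h [hc fE]] a b [y [ay by_]]; exists (h y).
have hcl (s : set X) : closure (cpt_map c2 @` s) y ->
    closure (cpt_map c1 @` s) (h y).
  move=> sy V hV; have [_ [[x sx <-] Vx]] := sy _ (hc _ _ hV).
  by exists (cpt_map c1 x); split; [exists x | rewrite fE].
by split; exact: hcl.
Qed.

(** Open subsets of [c1] pull back to open subsets of [X]; their closures are the
    regular closed sets to which the hypothesis is applied. *)
Lemma cpt_contact_reflects_le (c1 c2 : compactification X) :
  (forall a b, cpt_contact c2 a b -> cpt_contact c1 a b) -> cpt_le c1 c2.
Proof.
move=> C21; have [_ fc _] := cpt_embedding c1.
apply: dense_extension.
- exact: cpt_dense.
- exact: cpt_compact.
- exact: cpt_hausdorff.
move=> U V oU oV UV.
have oP W : open W -> open (cpt_map c1 @^-1` W) by move/continuousP: fc; exact.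
pose r W (oW : open W) : RC X := MkRC (closure_open_regclosed (oP W oW)).
rewrite -subset0 => y [Uy Vy].
have : cpt_contact c2 (r U oU) (r V oV).
  by exists y; split; [move: Uy | move: Vy]; apply: closureS => _ [x ? <-];
    exists x => //; exact: subset_closure.
move=> /C21[z [/(closure_image_preimage fc) Uz]].
move=> /(closure_image_preimage fc) Vz.
by have : (closure U `&` closure V) z by []; rewrite UV.
Qed.

End contact_of_compactification.

(** * The compactification given by an admissible contact relation *)

Section cluster_compactification.
Context {X : topologicalType} (Xlc : locally_compact [set: X])
  (Xh : hausdorff_space X).
Context {C : RC X -> RC X -> Prop} (aC : admissible_contact C).

Let nC := admissible_normal aC.

(** Maximality is where local compactness and (RC2) enter: if [x] is not in [a],
    some compact regular closed neighbourhood of [x] misses [a], hence is not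
    in contact with [a]. *)
Lemma point_contact_cluster (x : X) :
  contact_cluster C [set a : RC X | rc_set a x].
Proof.
split=> // a; split=> [ax b bx|xC] /=.
  by apply: (admissible_RC1 aC); exists x.
apply: contrapT => nax.
have [b [bc bx ba]] := compact_rc_nbhs Xlc Xh (closed_openC (rc_closed a)) nax.
have [z [az bz]] : rho a b.
  by apply: (admissible_RC2 aC) bc _; apply: xC; exact: interior_subset bx.
exact: ba bz az.
Qed.

Definition point_cluster (x : X) : cluster_space C :=
  exist _ _ (point_contact_cluster x).

Lemma rc_separate (x : X) (U : set X) : open U -> U x ->
  exists a : RC X, ~ rc_set a x /\ ~` a `<=` U.
Proof.
move=> oU Ux; have [b [_ bx bU]] := compact_rc_nbhs Xlc Xh oU Ux.
exists (~` b)%O; rewrite rc_set_compl closure_setC setCK; split; first by [].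
exact: subset_trans (@interior_subset _ _) bU.
Qed.

Lemma point_cluster_embedding : homeomorphic_embedding point_cluster.
Proof.
split.
- move=> x y xy; apply/eqP; apply: contraT => nxy.
  have oU : open (~` [set y]).
    by apply: closed_openC; apply: accessible_closed_set1;
      exact: hausdorff_accessible.
  have [|a [ax ay]] := @rc_separate x _ oU.
    by move=> /= E; rewrite E eqxx in nxy.
  have nay : ~ sval (point_cluster x) a by [].
  apply: contrapT => _; apply: (ay y) => //.
  by rewrite xy in nay.
- apply/continuousP => V oV; rewrite openE => x /oV[a /= ax aV].
  apply: (filterS (P := ~` a)) => [z az|]; first exact: aV.
  by apply: open_nbhs_nbhs; split=> //; exact: closed_openC (rc_closed a).
- move=> U oU; exists [set s : cluster_space C |
      exists2 a : RC X, ~ sval s a & ~` a `<=` U].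
    move=> s [a sa aU]; exists a => //.
    by move=> t /= ta; exists a.
  apply/seteqP; split=> [_ [x Ux <-]|t [[a ta aU] [x _ xt]]].
    split; last by exists x.
    by have [a [ax aU]] := rc_separate oU Ux; exists a.
  by exists x => //; apply: aU => /=; move: ta; rewrite -xt.
Qed.

Lemma point_cluster_dense : dense (range point_cluster).
Proof.
move=> V [s Vs] oV; have [a sa aV] := oV _ Vs.
have [|x ax] := @rc_proper _ a.
  move=> aT; case: (cluster_compl nC s a) => //.
  by rewrite aT compl1; exact: cluster_bot (svalP s).
by exists (point_cluster x); split; [exact: aV | exists x].
Qed.

Definition cluster_compactification : compactification X :=
  Compactification (cluster_space_compact nC) (cluster_space_hausdorff nC)
    point_cluster_embedding point_cluster_dense.

Lemma closure_point_cluster (a : RC X) :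
  closure (point_cluster @` a) = [set s | sval s a].
Proof.
apply/seteqP; split.
  have /closure_id E := @closed_mem_cluster _ _ C a.
  rewrite [X in _ `<=` X]E.
  by apply: closureS => _ [x ax <-].
move=> s sa V; rewrite nbhsE => -[W [oW Ws] WV].
have [b sb bW] := oW _ Ws.
have [x [ax bx]] : exists x, rc_set a x /\ ~ rc_set b x.
  apply: contrapT => nab; apply: sb; apply: cluster_le sa.
  apply/rc_leP => x ax; apply: contrapT => bx; apply: nab; by exists x.
by exists (point_cluster x); split; [exists x | apply: WV; exact: bW].
Qed.

(** The elements [e] not in contact with [b] form an ideal that contains no
    element above [a], so the sets [a `\` e] generate a proper filter on [X].
    Any cluster [s] adherent to it contains [a].  It contains [b] too: otherwise
    (C5) gives such an [e] with [~` e] not in [s], although [s] is adherent to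
    the points outside [e]. *)
Lemma contact_cluster_ex (a b : RC X) :
  C a b -> exists s : cluster_space C, sval s a /\ sval s b.
Proof.
move=> ab.
pose F := filter_from [set e | ~ C e b]
  (fun e : RC X => point_cluster @` (a `\` e)).
have FF : ProperFilter F.
  apply: filter_from_proper.
    apply: filter_from_filter.
      by exists \bot%O => /(normal_contact2 nC)[].
    move=> e1 e2 e1b e2b; exists (e1 `|` e2)%O.
      by case/(contact_joinl nC).
    by move=> _ [x [ax /not_orP[e1x e2x]] <-]; split; exists x.
  move=> e eb; apply: contrapT => ae; apply: eb.
  apply: (contact_le2 nC) ab => //.
  apply/rc_leP => x ax; apply: contrapT => ex; apply: ae.
  by exists (point_cluster x), x.
have Fe e : ~ C e b -> F (point_cluster @` (a `\` e)) by exists e.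
have [s [_ Fs]] := cluster_space_compact nC FF filterT.
have Fcl e : ~ C e b -> closure (point_cluster @` (a `\` e)) s.
  by move=> eb V sV; exact: Fs (Fe _ eb) sV.
exists s; split.
  have /Fcl : ~ C \bot%O b by case/(normal_contact2 nC).
  have : point_cluster @` (a `\` (\bot%O : RC X)) `<=` point_cluster @` a.
    by move=> _ [x [ax _] <-]; exists x.
  by move=> /closureS/[apply]; rewrite closure_point_cluster.
apply: contrapT => /(cluster_separate nC)[e be se]; apply: se.
have /Fcl : ~ C e b by move=> /(normal_contact3 nC).
have : point_cluster @` (a `\` e) `<=` point_cluster @` (~` e)%O.
  by move=> _ [x [_ ex] <-]; exists x => //; exact: subset_closure.
by move=> /closureS/[apply]; rewrite closure_point_cluster.
Qed.

Lemma cluster_compactification_contact (a b : RC X) :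
  cpt_contact cluster_compactification a b <-> C a b.
Proof.
rewrite /cpt_contact /= !closure_point_cluster; split.
  by move=> [s [sa sb]]; exact: cluster_contact sa sb.
by move=> /contact_cluster_ex[s [sa sb]]; exists s.
Qed.

End cluster_compactification.

(** * The isomorphism *)

Lemma poset_refl (P : poset) (x : P) : poset_le x x.
Proof. by case: (poset_order P) => refl _ _; exact: refl. Qed.

Lemma poset_anti (P : poset) (x y : P) :
  poset_le x y -> poset_le y x -> x = y.
Proof. by case: (poset_order P) => _ _ anti; exact: anti. Qed.

Theorem corollary2p11 (X : topologicalType)
  (Xlc : locally_compact [set: X]) (Xh : hausdorff_space X) :
  exists mu_c : K X -> Ka X, poset_isomorphism mu_c.
Proof.
pose contact (c : compactification X) : Ka X :=
  exist _ _ (cpt_contact_admissible c Xlc Xh).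
pose mu (S : K X) : Ka X := contact (sval (cid (cpt_class_surj S))).
pose nu (D : Ka X) : K X :=
  cpt_class (cluster_compactification Xlc Xh (svalP D)).
have le_mu S1 S2 : poset_le S1 S2 <-> poset_le (mu S1) (mu S2).
  rewrite /mu; case: cid => c1 /= ->; case: cid => c2 /= ->.
  split=> [/cpt_class_le|]; first exact: cpt_contact_le.
  by move=> c12; apply/cpt_class_le/cpt_contact_reflects_le.
have mu_nu : cancel nu mu.
  move=> D; rewrite /mu; case: cid => c /= /cpt_class_eq nuD_c.
  have cD a b : cpt_contact c a b <-> sval D a b.
    rewrite -(cluster_compactification_contact Xlc Xh (svalP D)).
    split; apply: cpt_contact_le; first exact: cpt_equiv_le.
    exact/cpt_equiv_le/cpt_equiv_sym.
  by apply: (@poset_anti (Ka X)) => a b /cD.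
exists mu; split=> //; exists nu => // S.
by apply: (@poset_anti (K X)); apply/le_mu; rewrite mu_nu;
  exact: (@poset_refl (Ka X)).
Qed.
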